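(* Let $N$ be a positive integer, $a(k)\in\mathbb{H}$ and $b(k)\in\mathbb{H}\setminus\{0\}$ for $0\le k\le N$, and $h_1,h_2\in\mathbb{H}$. Let $\mathcal{L}$ be the associated difference operator on $\mathbb{H}^N$ and let $\phi(k,\lambda,s)$ and $\boldsymbol{\varphi}(\lambda,s)=[\phi(1,\lambda,s),\dots,\phi(N,\lambda,s)]^\top$ be the associated solution functions (all defined in the context). Suppose that $\mathcal{L}$ is normal. For any fixed $s\in\mathbb{H}\setminus\{0\}$, let $f_s:\mathbb{H}\to\mathbb{H}$ be a function defined by the discrete transform $$f_s(\lambda):=\sum_{k=1}^{N}\overline{F(k)}\,\phi(k,\lambda,s),\qquad F(k)\in\mathbb{H},\ k=1,2,\dots,N.$$ Then there exist $\lambda_1,\lambda_2,\dots,\lambda_N\in\mathbb{H}$, which depend on $s$, such that for all $\lambda\in\mathbb{H}$ $$f_s(\lambda)=\sum_{k=1}^{N}f_s(\lambda_k)\,\psi_k(\lambda,s),\qquad\text{where}\quad \psi_k(\lambda,s)=\frac{\langle\boldsymbol{\varphi}(\lambda_k,s),\boldsymbol{\varphi}(\lambda,s)\rangle}{\|\boldsymbol{\varphi}(\lambda_k,s)\|^2}.$$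
   Context: $\mathbb{H}$ is the skew field of real quaternions, $\overline{q}$ the quaternion conjugate. $\mathbb{H}^N$ is regarded as a right $\mathbb{H}$-module with inner product $\langle\boldsymbol{\xi},\boldsymbol{\eta}\rangle=\boldsymbol{\xi}^*\boldsymbol{\eta}=\sum_k\overline{\xi_k}\eta_k$ and norm $\|\boldsymbol{\xi}\|=\sqrt{\langle\boldsymbol{\xi},\boldsymbol{\xi}\rangle}$. Consider the difference equation $$(E)\quad b(k)x(k+1)+a(k)x(k)+b(k-1)x(k-1)=x(k)\lambda,\quad k=1,2,\dots,N,$$ with parameter $\lambda\in\mathbb{H}$, and the boundary conditions $$(B_1)\quad x(0)+h_1x(1)=0,\qquad (B_2)\quad x(N+1)+h_2x(N)=0.$$ The right $\mathbb{H}$-linear operator $\mathcal{L}$ on $\mathbb{H}^N$ is defined for $\boldsymbol{x}=[x(1),\dots,x(N)]^\top$ by $(\mathcal{L}\boldsymbol{x})(k)=b(k)x(k+1)+a(k)x(k)+b(k-1)x(k-1)$, $1\le k\le N$, where $x(0):=-h_1x(1)$ and $x(N+1):=-h_2x(N)$. It is normal if $\mathcal{L}\mathcal{L}^*=\mathcal{L}^*\mathcal{L}$, where $\mathcal{L}^*$ is the adjoint with respect to $\langle\cdot,\cdot\rangle$. For $\lambda,s\in\mathbb{H}$, $\phi(k,\lambda,s)$ ($0\le k\le N+1$) denotes the unique solution $x(k)$ of $(E)$ and $(B_1)$ with $x(1)=s$. *)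

(* Defs.v *)
From HB Require Import structures.
From mathcomp Require Import all_boot all_order all_algebra.
From mathcomp Require Import reals.
From mathcomp Require Import ring lra.

Set Implicit Arguments.
Unset Strict Implicit.
Unset Printing Implicit Defensive.

Import Order.TTheory GRing.Theory Num.Theory.
Local Open Scope ring_scope.

(* Quat p q r t stands for p + q i + r j + t k. *)
Record quat (R : realType) := Quat { qre : R; qi : R; qj : R; qk : R }.

Section Quaternions.
Variable R : realType.
Local Notation H := (quat R).

Definition tuple_of_quat (x : H) := (qre x, qi x, qj x, qk x).
Definition quat_of_tuple (t : R * R * R * R) : H :=
  let: (p, q, r, s) := t in Quat p q r s.
Lemma tuple_of_quatK : cancel tuple_of_quat quat_of_tuple.
Proof. by case. Qed.

HB.instance Definition _ := Choice.copy H (can_type tuple_of_quatK).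

Definition qadd (x y : H) : H :=
  Quat (qre x + qre y) (qi x + qi y) (qj x + qj y) (qk x + qk y).
Definition qopp (x : H) : H := Quat (- qre x) (- qi x) (- qj x) (- qk x).

Lemma qaddA : associative qadd.
Proof. by move=> [????] [????] [????]; rewrite /qadd /= !addrA. Qed.
Lemma qaddC : commutative qadd.
Proof. by move=> [????] [????]; rewrite /qadd /=; congr Quat; rewrite addrC. Qed.
Lemma qadd0 : left_id (Quat 0 0 0 0) qadd.
Proof. by move=> [????]; rewrite /qadd /= !add0r. Qed.
Lemma qaddN : left_inverse (Quat 0 0 0 0) qopp qadd.
Proof. by move=> [????]; rewrite /qadd /= !addNr. Qed.

HB.instance Definition _ := GRing.isZmodule.Build H qaddA qaddC qadd0 qaddN.

Definition qmul (x y : H) : H :=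
  Quat (qre x * qre y - qi x * qi y - qj x * qj y - qk x * qk y)
       (qre x * qi y + qi x * qre y + qj x * qk y - qk x * qj y)
       (qre x * qj y - qi x * qk y + qj x * qre y + qk x * qi y)
       (qre x * qk y + qi x * qj y - qj x * qi y + qk x * qre y).

Lemma qmulA : associative qmul.
Proof. by move=> [????] [????] [????]; rewrite /qmul /qadd /=; congr Quat; ring. Qed.
Lemma qmul1 : left_id (Quat 1 0 0 0) qmul.
Proof. by move=> [????]; rewrite /qmul /qadd /=; congr Quat; ring. Qed.
Lemma qmulr1 : right_id (Quat 1 0 0 0) qmul.
Proof. by move=> [????]; rewrite /qmul /qadd /=; congr Quat; ring. Qed.
Lemma qmulDl : left_distributive qmul qadd.
Proof. by move=> [????] [????] [????]; rewrite /qmul /qadd /=; congr Quat; ring. Qed.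
Lemma qmulDr : right_distributive qmul qadd.
Proof. by move=> [????] [????] [????]; rewrite /qmul /qadd /=; congr Quat; ring. Qed.
Lemma qone_neq0 : Quat 1 0 0 0 != 0 :> H.
Proof. by apply/eqP => -[] /eqP; rewrite oner_eq0. Qed.

HB.instance Definition _ := GRing.Zmodule_isNzRing.Build H
  qmulA qmul1 qmulr1 qmulDl qmulDr qone_neq0.

Definition qreal (r : R) : H := Quat r 0 0 0.
Definition qconj (x : H) : H := Quat (qre x) (- qi x) (- qj x) (- qk x).
Definition qnormsq (x : H) : R :=
  qre x ^+ 2 + qi x ^+ 2 + qj x ^+ 2 + qk x ^+ 2.

Lemma qnormsq_eq0 x : (qnormsq x == 0) = (x == 0).
Proof.
apply/eqP/eqP => [|->]; last by rewrite /qnormsq /= !expr0n /= !addr0.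
case: x => p q r s; rewrite /qnormsq /= => h.
have := (sqr_ge0 p, sqr_ge0 q, sqr_ge0 r, sqr_ge0 s).
move=> [[[hp hq] hr] hs].
by congr Quat; apply/eqP; rewrite -sqrf_eq0; apply/eqP; lra.
Qed.

Definition qinv (x : H) : H := qreal (qnormsq x)^-1 * qconj x.

Lemma qinv0 : qinv 0 = 0.
Proof. by rewrite /qinv (eqP (etrans (qnormsq_eq0 0) (eqxx _))) invr0 mul0r. Qed.

Lemma qmulVx (x : H) : x != 0 -> qinv x * x = 1.
Proof.
rewrite -qnormsq_eq0; case: x => p q r s; rewrite /qnormsq /= => h.
by congr Quat; rewrite /= /qnormsq /=; field.
Qed.

Lemma qmulxV (x : H) : x != 0 -> x * qinv x = 1.
Proof.
rewrite -qnormsq_eq0; case: x => p q r s; rewrite /qnormsq /= => h.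
by congr Quat; rewrite /= /qnormsq /=; field.
Qed.

Lemma qunitP (x y : H) : y * x = 1 /\ x * y = 1 -> x != 0.
Proof.
by case=> yx _; apply/eqP => x0; move/eqP: yx; rewrite x0 mulr0 eq_sym oner_eq0.
Qed.

Lemma qinv_out : {in [predC [pred x : H | x != 0]], qinv =1 id}.
Proof. by move=> x; rewrite !inE negbK => /eqP ->; exact: qinv0. Qed.

HB.instance Definition _ := GRing.NzRing_hasMulInverse.Build H
  qmulVx qmulxV qunitP qinv_out.

Lemma quat_unitE (x : H) : (x \is a GRing.unit) = (x != 0).
Proof. by []. Qed.

Lemma qconjD : {morph qconj : x y / x + y}.
Proof. by move=> [????] [????]; congr Quat => /=; ring. Qed.
Lemma qconj0 : qconj 0 = 0.
Proof. by congr Quat; rewrite oppr0. Qed.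
Lemma qconj1 : qconj 1 = 1.
Proof. by congr Quat; rewrite oppr0. Qed.
Lemma qconjM (x y : H) : qconj (x * y) = qconj y * qconj x.
Proof. by case: x y => [????] [????]; congr Quat => /=; ring. Qed.
Lemma qconjMx (x : H) : qconj x * x = qreal (qnormsq x).
Proof. by case: x => ????; congr Quat; rewrite /qnormsq /=; ring. Qed.
Lemma qrealD : {morph qreal : x y / x + y}.
Proof. by move=> x y; congr Quat => /=; rewrite addr0. Qed.

Section Vectors.
Variable N : nat.
Implicit Types (x y : 'cV[H]_N) (T S : 'cV[H]_N -> 'cV[H]_N).

Definition qdot x y : H := \sum_(i < N) qconj (x i 0) * y i 0.

Lemma qdotxx_real x : qdot x x = qreal (qre (qdot x x)).
Proof.
have -> : qdot x x = qreal (\sum_(i < N) qnormsq (x i 0)).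
  rewrite (big_morph qreal qrealD (erefl _)).
  by apply: eq_bigr => i _; rewrite qconjMx.
by [].
Qed.

(* By qdotxx_real, taking the real part loses nothing. *)
Definition qnorm x : R := Num.sqrt (qre (qdot x x)).

Definition is_adjoint T S := forall x y, qdot (T x) y = qdot x (S y).

Definition normal_op T :=
  exists S, is_adjoint T S /\ (forall x, T (S x) = S (T x)).

(* x *m q%:M is the vector x multiplied by the scalar q on the right. *)
Definition right_linear T :=
  {morph T : x y / x + y} /\ forall x (q : H), T (x *m q%:M) = T x *m q%:M.

Lemma qdot_delta i y : qdot (delta_mx i 0) y = y i 0.
Proof.
rewrite /qdot (bigD1 i) //= mxE !eqxx qconj1 mul1r big1 ?addr0 // => j ji.
by rewrite mxE (negbTE ji) qconj0 mul0r.
Qed.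

Lemma is_adjoint_uniq T S S' : is_adjoint T S -> is_adjoint T S' -> S =1 S'.
Proof.
move=> hS hS' y; apply/colP => i.
by rewrite -[LHS]qdot_delta -hS hS' qdot_delta.
Qed.

Lemma right_linear_adjoint T : right_linear T -> exists S, is_adjoint T S.
Proof.
move=> [TD TZ]; have T0 : T 0 = 0 by apply: (addrI (T 0)); rewrite -TD !addr0.
exists (fun y => \col_i qdot (T (delta_mx i 0)) y) => x y.
have defx : x = \sum_(i < N) delta_mx i 0 *m (x i 0)%:M.
  apply/colP => k; rewrite summxE (bigD1 k) //= big1 => [|j jk].
    by rewrite addr0 mxE big_ord1 !mxE !eqxx mul1r.
  by rewrite mxE big_ord1 !mxE eq_sym (negbTE jk) mul0r.
have TE k : T x k 0 = \sum_(i < N) T (delta_mx i 0) k 0 * x i 0.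
  rewrite {1}defx (big_morph T TD T0) summxE; apply: eq_bigr => i _.
  by rewrite TZ mxE big_ord1 mxE eqxx mulr1n.
rewrite /qdot.
under eq_bigr => k _ do
  rewrite TE (big_morph qconj qconjD qconj0) mulr_suml.
rewrite exchange_big; apply: eq_bigr => i _ /=; rewrite mxE mulr_sumr.
by apply: eq_bigr => k _; rewrite qconjM mulrA.
Qed.

End Vectors.

Section Equation.
Variables (N : nat) (a b : nat -> H) (h1 h2 : H).

Definition diff_expr (x : nat -> H) (k : nat) : H :=
  b k * x k.+1 + a k * x k + b k.-1 * x k.-1.

Definition solves_E (lambda : H) (x : nat -> H) :=
  forall k, (1 <= k <= N)%N -> diff_expr x k = x k * lambda.

Definition solves_B1 (x : nat -> H) := x 0%N + h1 * x 1%N = 0.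

(* Only the values x 0, ..., x N.+1 matter. *)
Definition is_phi (lambda s : H) (x : nat -> H) :=
  [/\ solves_E lambda x, solves_B1 x & x 1%N = s].

(* The pair of x k and x k.+1 computed by solving the recurrence forward. *)
Fixpoint phi_pair (lambda s : H) (k : nat) : H * H :=
  if k is k'.+1 then
    let: (u, v) := phi_pair lambda s k' in
    (v, (b k)^-1 * (v * lambda - a k * v - b k' * u))
  else (- (h1 * s), s).

Lemma is_phi_exists (lambda s : H) :
  (forall k, (k <= N)%N -> b k != 0) -> exists x, is_phi lambda s x.
Proof.
move=> bn0; exists (fun k => (phi_pair lambda s k).1); split => //.
- case=> // k /andP[_ kN]; rewrite /diff_expr /=.
  case: (phi_pair lambda s k) => u v /=.
  by rewrite mulVKr ?quat_unitE ?bn0 // addrAC !subrK.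
- by rewrite /solves_B1 /= addNr.
Qed.

Lemma is_phi_uniq (lambda s : H) x y :
  (forall k, (k <= N)%N -> b k != 0) -> is_phi lambda s x -> is_phi lambda s y ->
  forall k, (k <= N.+1)%N -> x k = y k.
Proof.
move=> bn0 [xE xB x1] [yE yB y1].
have x0 : x 0%N = y 0%N.
  by move: xB yB; rewrite /solves_B1 x1 y1 => <- /addIr.
suff h k : (k <= N)%N -> x k = y k /\ x k.+1 = y k.+1.
  by case=> // k /h [].
elim: k => [|k IH] kN; first by rewrite x1 y1.
have [xk xk1] := IH (ltnW kN); split => //.
have := xE k.+1 kN; rewrite xk1 -(yE k.+1 kN) /diff_expr /= xk xk1.
by move=> /addIr /addIr; apply: mulrI; rewrite quat_unitE bn0.
Qed.

Definition coord (x : 'cV[H]_N) (k : nat) : H :=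
  if insub k.-1 is Some i then x i 0 else 0.

Definition extend (x : 'cV[H]_N) (k : nat) : H :=
  if k == 0%N then - (h1 * coord x 1%N)
  else if k == N.+1 then - (h2 * coord x N)
  else coord x k.

(* The entry of index i : 'I_N of a vector is its (i+1)-st one. *)
Definition vec (x : nat -> H) : 'cV[H]_N := \col_(i < N) x i.+1.

Definition diff_op (x : 'cV[H]_N) : 'cV[H]_N := vec (diff_expr (extend x)).

Lemma diff_op_right_linear : right_linear diff_op.
Proof.
have cD x y k : coord (x + y) k = coord x k + coord y k.
  by rewrite /coord; case: insubP => [i _ _|_]; rewrite ?mxE ?addr0.
have cZ x (q : H) k : coord (x *m q%:M) k = coord x k * q.
  rewrite /coord; case: insubP => [i _ _|_]; rewrite ?mul0r //.
  by rewrite mxE big_ord1 mxE eqxx mulr1n.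
have eD x y k : extend (x + y) k = extend x k + extend y k.
  by rewrite /extend !cD !mulrDr !opprD; do 2 case: ifP => // _.
have eZ x (q : H) k : extend (x *m q%:M) k = extend x k * q.
  by rewrite /extend !cZ !mulrA -!mulNr; do 2 case: ifP => // _.
split=> [x y|x q]; apply/colP => i; rewrite !mxE /diff_expr.
  by rewrite !eD !mulrDr [X in X + _ = _]addrACA [LHS]addrACA.
by rewrite big_ord1 !mxE eqxx mulr1n /diff_expr !eZ !mulrDl !mulrA.
Qed.

Lemma diff_op_adjoint : exists S, is_adjoint diff_op S.
Proof. exact/right_linear_adjoint/diff_op_right_linear. Qed.

End Equation.
End Quaternions.

(* Main.v *)
Require Import Defs.
From mathcomp Require Import all_boot all_order all_algebra.
From mathcomp Require Import reals.
From mathcomp Require Import complex ring.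
Import Order.TTheory GRing.Theory Num.Theory.
Local Open Scope ring_scope.

(** A right eigenvector x of the operator is determined by x(1), which is
    therefore nonzero; replacing x by x q turns the eigenvalue l into
    q^-1 l q, so every eigenvector can be rescaled to some phi(., l', s).  It
    thus suffices to expand in an orthogonal basis of eigenvectors of a normal
    operator T.  If k < N orthogonal eigenvectors are given, normality makes
    their orthogonal complement T-invariant, and it contains some w <> 0.  The
    iterates of T on w are dependent over the reals, so a nonzero polynomial
    in T kills w; splitting off one complex root at a time yields an
    eigenvector inside the complement. *)

Set Implicit Arguments.
Unset Strict Implicit.

(** * Quaternion scalars, with the real and complex numbers inside them *)

Section QuaternionScalars.
Variable R : realType.
Implicit Types (p q : quat R) (r : R).

Lemma qconjK q : qconj (qconj q) = q.
Proof. by case: q => ????; rewrite /qconj /= !opprK. Qed.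

Lemma qreal_comm r q : qreal r * q = q * qreal r.
Proof. by case: q => ????; congr Quat => /=; ring. Qed.

Lemma qrealM r r' : qreal (r * r') = qreal r * qreal r'.
Proof. by congr Quat => /=; ring. Qed.

Lemma qrealV r : (qreal r)^-1 = qreal r^-1.
Proof.
have [->|r0] := eqVneq r 0; first by rewrite invr0 invr0.
have u : qreal r != 0 by apply: contraNneq r0 => -[->].
apply: (@mulrI _ (qreal r)); first by rewrite quat_unitE.
by rewrite -qrealM divff // mulrV ?quat_unitE.
Qed.

Lemma qmulxC q : q * qconj q = qreal (qnormsq q).
Proof. by case: q => ????; congr Quat; rewrite /qnormsq /=; ring. Qed.

Lemma qnormsq_ge0 q : 0 <= qnormsq q.
Proof. by rewrite /qnormsq !addr_ge0 ?sqr_ge0. Qed.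

Lemma sum_Quat (I : Type) (r : seq I) (f1 f2 f3 f4 : I -> R) :
  \sum_(i <- r) Quat (f1 i) (f2 i) (f3 i) (f4 i) =
  Quat (\sum_(i <- r) f1 i) (\sum_(i <- r) f2 i)
       (\sum_(i <- r) f3 i) (\sum_(i <- r) f4 i) :> quat R.
Proof.
by elim: r => [|i r IH]; rewrite ?big_nil // !big_cons IH.
Qed.

(** Embeds a commutative, algebraically closed subfield, over which a polynomial in an operator
    splits into linear factors. *)
Definition qc (z : R[i]) : quat R := Quat (complex.Re z) (complex.Im z) 0 0.

Lemma qcM z z' : qc (z * z') = qc z * qc z'.
Proof. by case: z z' => [??] [??]; congr Quat => /=; ring. Qed.

Lemma qcB z z' : qc (z - z') = qc z - qc z'.
Proof. by case: z z' => [??] [??]; congr Quat => /=; ring. Qed.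

Lemma qc_eq0 z : (qc z == 0) = (z == 0).
Proof. by apply/eqP/eqP => [|->]//; case: z => x y [-> ->]. Qed.

End QuaternionScalars.

(** * The inner product on the right module [H^N] *)

Section QuaternionVectors.
Variables (R : realType) (N : nat).
Local Notation H := (quat R).
Implicit Types (x y z : 'cV[H]_N) (q : H).

(** A real value free of square roots; being real, it commutes with all quaternions once
    embedded. *)
Definition qsqnorm x : R := \sum_(i < N) qnormsq (x i 0).

Lemma qdotxx x : qdot x x = qreal (qsqnorm x).
Proof.
rewrite /qsqnorm (big_morph _ (@qrealD R) (erefl _)).
by apply: eq_bigr => i _; rewrite qconjMx.
Qed.

Lemma qsqnorm_ge0 x : 0 <= qsqnorm x.
Proof. by apply: sumr_ge0 => i _; apply: qnormsq_ge0. Qed.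

Lemma qsqnorm_eq0 x : (qsqnorm x == 0) = (x == 0).
Proof.
rewrite psumr_eq0 => [|i _]; last exact: qnormsq_ge0.
apply/allP/eqP => [h|-> i _].
  apply/colP => i; have := h i (mem_index_enum i).
  by rewrite /= qnormsq_eq0 mxE => /eqP.
by rewrite /= qnormsq_eq0 mxE.
Qed.

Lemma qnorm_sqr x : qnorm x ^+ 2 = qsqnorm x.
Proof. by rewrite /qnorm qdotxx sqr_sqrtr ?qsqnorm_ge0. Qed.

Lemma scalE x q i : (x *m q%:M) i 0 = x i 0 * q.
Proof. by rewrite mxE big_ord1 mxE eqxx mulr1n. Qed.

Lemma scalA x q q' : x *m q%:M *m q'%:M = x *m (q * q')%:M.
Proof. by rewrite -mulmxA -scalar_mxM. Qed.

Lemma scal_eq0 x q : q != 0 -> (x *m q%:M == 0) = (x == 0).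
Proof.
move=> q0; apply/eqP/eqP => [h|->]; last by rewrite mul0mx.
by rewrite -[x]mulmx1 -(@divrr _ q) ?quat_unitE // -scalA h mul0mx.
Qed.

Lemma qdotC x y : qdot x y = qconj (qdot y x).
Proof.
rewrite /qdot (big_morph _ (@qconjD R) (@qconj0 R)).
by apply: eq_bigr => i _; rewrite qconjM qconjK.
Qed.

Lemma qdotDr x y z : qdot x (y + z) = qdot x y + qdot x z.
Proof. by rewrite -big_split; apply: eq_bigr => i _; rewrite mxE mulrDr. Qed.

Lemma qdotDl x y z : qdot (x + y) z = qdot x z + qdot y z.
Proof. by rewrite qdotC qdotDr qconjD -!qdotC. Qed.

Lemma qdotZr x y q : qdot x (y *m q%:M) = qdot x y * q.
Proof. by rewrite /qdot mulr_suml; apply: eq_bigr => i _; rewrite scalE mulrA. Qed.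

Lemma qdotZl x y q : qdot (x *m q%:M) y = qconj q * qdot x y.
Proof. by rewrite qdotC qdotZr qconjM -qdotC. Qed.

Lemma qdot0r x : qdot x 0 = 0.
Proof. by apply: (addrI (qdot x 0)); rewrite -qdotDr !addr0. Qed.

Lemma qdot0l x : qdot 0 x = 0.
Proof. by rewrite qdotC qdot0r qconj0. Qed.

Lemma qdotNr x y : qdot x (- y) = - qdot x y.
Proof. by apply: (addrI (qdot x y)); rewrite -qdotDr !subrr qdot0r. Qed.

Lemma qdotNl x y : qdot (- x) y = - qdot x y.
Proof. by apply: (addrI (qdot x y)); rewrite -qdotDl !subrr qdot0l. Qed.

Lemma qdot_sumr (k : nat) x (F : nat -> 'cV[H]_N) :
  qdot x (\sum_(i < k) F i) = \sum_(i < k) qdot x (F i).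
Proof. exact: (big_morph (qdot x) (qdotDr x) (qdot0r x)). Qed.

Lemma qdot_suml (k : nat) x (F : nat -> 'cV[H]_N) :
  qdot (\sum_(i < k) F i) x = \sum_(i < k) qdot (F i) x.
Proof.
rewrite qdotC qdot_sumr (big_morph _ (@qconjD R) (@qconj0 R)).
by apply: eq_bigr => i _; rewrite -qdotC.
Qed.

(** * Orthogonal projection, extension and completeness *)

Section OrthogonalFamily.
Variables (k : nat) (e : nat -> 'cV[H]_N).
Hypothesis e_neq0 : forall i, (i < k)%N -> e i != 0.
Hypothesis e_orth : forall i j, (i < k)%N -> (j < k)%N -> i != j ->
  qdot (e i) (e j) = 0.

(** The orthogonal projection onto the right span of the [e i]. *)
Definition oproj x : 'cV[H]_N :=
  \sum_(i < k) e i *m (qdot (e i) x * qreal (qsqnorm (e i))^-1)%:M.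

Lemma qdot_oproj x j : (j < k)%N -> qdot (e j) (x - oproj x) = 0.
Proof.
move=> jk; rewrite qdotDr qdotNr.
rewrite (qdot_sumr _ _ (fun i =>
  e i *m (qdot (e i) x * qreal (qsqnorm (e i))^-1)%:M)).
rewrite (bigD1 (Ordinal jk)) //= big1 => [|i ij]; last first.
  by rewrite qdotZr e_orth ?mul0r // eq_sym;
     apply: contra ij => /eqP ij; apply/eqP/val_inj.
rewrite addr0 qdotZr qdotxx mulrA -qreal_comm mulrA -qrealM.
by rewrite mulVf ?qsqnorm_eq0 ?e_neq0 // mul1r subrr.
Qed.

Lemma qdot_oprojl y x : (forall i, (i < k)%N -> qdot (e i) x = 0) ->
  qdot (oproj y) x = 0.
Proof.
move=> ex; rewrite (qdot_suml _ _ (fun i =>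
  e i *m (qdot (e i) y * qreal (qsqnorm (e i))^-1)%:M)).
by apply: big1 => i _; rewrite qdotZl ex ?mulr0.
Qed.

(** Since [d - oproj d] is orthogonal to [oproj d], its squared norm is its inner product with [d],
    that is, its entry [m]: a diagonal entry of the complementary projection. *)
Lemma qsqnorm_oproj_delta m :
  qsqnorm (delta_mx m 0 - oproj (delta_mx m 0)) =
  1 - \sum_(i < k) qnormsq (e i m 0) / qsqnorm (e i).
Proof.
set d := delta_mx m 0.
suff : qreal (qsqnorm (d - oproj d)) =
    qreal (1 - \sum_(i < k) qnormsq (e i m 0) / qsqnorm (e i)) by case.
rewrite -qdotxx qdotDl qdotNl (@qdot_oprojl d); last exact: qdot_oproj.
have qrealB r r' : qreal (r - r') = qreal r - qreal r' :> H.
  by congr Quat => /=; rewrite subrr.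
rewrite subr0 qdot_delta qrealB !mxE !eqxx summxE.
rewrite (big_morph _ (@qrealD R) (erefl _)); congr (_ - _).
apply: eq_bigr => i _; rewrite scalE mulrA qrealM; congr (_ * _).
by rewrite qdotC qdot_delta qmulxC.
Qed.

(* This trace identity stands in for dimension theory over a skew field. *)
Lemma sum_oproj_delta :
  \sum_(m < N) qsqnorm (delta_mx m 0 - oproj (delta_mx m 0)) = N%:R - k%:R.
Proof.
under eq_bigr do rewrite qsqnorm_oproj_delta.
rewrite sumrB exchange_big /= !sumr_const card_ord; congr (_ - _).
rewrite -[k in RHS]card_ord -sumr_const; apply: eq_bigr => i _.
by rewrite -mulr_suml divff // qsqnorm_eq0 e_neq0.
Qed.

(** If every unit vector were its own projection, the trace [N - k] would vanish; so some residual
    is nonzero. *)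
Lemma orthogonal_extend : (k < N)%N ->
  exists x, x != 0 /\ forall i, (i < k)%N -> qdot (e i) x = 0.
Proof.
move=> kN; have [m hm|h] := pickP (fun m : 'I_N =>
  delta_mx m 0 - oproj (delta_mx m 0) != 0).
  eexists; split; first exact: hm.
  by move=> i ik; apply: qdot_oproj.
have := sum_oproj_delta; rewrite big1 => [/esym/eqP|m _].
  by rewrite subr_eq0 eqr_nat gtn_eqF.
by apply/eqP; rewrite qsqnorm_eq0; have /negbFE := h m.
Qed.

(** The trace is now 0 and its terms are nonnegative, so each unit vector is its own projection.
    Entry [m] of the residual of [x] is then its inner product with a vector of the span, hence
    0. *)
Lemma orthogonal_complete x : k = N ->
  x = \sum_(i < k) e i *m (qdot (e i) x * qreal (qsqnorm (e i))^-1)%:M.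
Proof.
move=> kN; apply/eqP; rewrite -subr_eq0; apply/eqP/colP => m.
have dm : delta_mx m 0 = oproj (delta_mx m 0).
  have /eqP := sum_oproj_delta; rewrite kN subrr psumr_eq0 => [/allP|i _].
    by move=> /(_ m (mem_index_enum m)); rewrite /= qsqnorm_eq0 subr_eq0 => /eqP.
  exact: qsqnorm_ge0.
rewrite -[LHS]qdot_delta dm mxE; apply: qdot_oprojl => i.
exact: qdot_oproj.
Qed.

End OrthogonalFamily.

(** * Eigenvectors of right linear and of normal operators *)

Section Eigenvectors.
Variable T : 'cV[H]_N -> 'cV[H]_N.
Hypothesis T_lin : right_linear T.

Let TD : {morph T : x y / x + y} := proj1 T_lin.
Let TZ x q : T (x *m q%:M) = T x *m q%:M := proj2 T_lin x q.

Lemma right_linear0 : T 0 = 0.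
Proof. by apply: (addrI (T 0)); rewrite -TD !addr0. Qed.

(* The coefficients act by right multiplication, through the embedding of the
   complex numbers in the quaternions: these actions commute with T. *)
Definition poly_act x n (p : {poly R[i]}) : 'cV[H]_N :=
  \sum_(i < n) iter i T x *m (qc p`_i)%:M.

Lemma poly_actMXsubC x n (q : {poly R[i]}) c : (size q <= n)%N ->
  poly_act x n.+1 (q * ('X - c%:P)) =
  T (poly_act x n q) - poly_act x n q *m (qc c)%:M.
Proof.
move=> qn; rewrite (big_morph T TD right_linear0) mulmx_suml.
have -> : poly_act x n.+1 (q * ('X - c%:P)) =
    \sum_(i < n.+1) iter i T x *m (qc (q * 'X)`_i)%:M
    - \sum_(i < n.+1) iter i T x *m (qc (q`_i * c))%:M.
  rewrite -sumrB; apply: eq_bigr => i _.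
  by rewrite -mulmxBr -raddfB -qcB mulrBr coefB coefMC.
(* The sum for [q * 'X] loses its constant term and is shifted by one; the sum for [q * c] loses its
   top term, by the bound on [size q]. *)
rewrite big_ord_recl coefMX eqxx raddf0 mulmx0 add0r.
rewrite [X in _ - X]big_ord_recr /= nth_default // mul0r raddf0 mulmx0 addr0.
congr (_ - _); apply: eq_bigr => i _; first by rewrite TZ coefMX.
by rewrite scalA qcM.
Qed.

(** Induction on the number of terms: for [p = q * ('X - c)], the vector [y] that [q] yields from
    [x] satisfies [T y = y c]. Either [y] is the eigenvector, or [q] also kills [x]. A nonzero
    constant cannot kill [x]. *)
Lemma poly_act_eigen (W : 'cV[H]_N -> Prop) x n (p : {poly R[i]}) :
  (forall y z, W y -> W z -> W (y + z)) ->
  (forall y q, W y -> W (y *m q%:M)) -> (forall y, W y -> W (T y)) ->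
  W x -> x != 0 -> p != 0 -> (size p <= n)%N -> poly_act x n p = 0 ->
  exists y l, [/\ W y, y != 0 & T y = y *m l%:M].
Proof.
move=> WD WZ WT Wx x0.
have W0 : W 0 by rewrite -(mulmx0 _ x) -(raddf0 (@scalar_mx H 1)); apply: WZ.
have Wi i : W (iter i T x) by elim: i => //= i; apply: WT.
elim: n p => [|n IH] p p0; first by rewrite leqn0 size_poly_eq0 (negbTE p0).
move=> pn pact; have [p1|p1] := leqP (size p) 1.
  move: pact p0; rewrite (size1_polyC p1) polyC_eq0 => pact p0.
  move/eqP: pact; rewrite /poly_act big_ord_recl big1 => [|i _].
    by rewrite addr0 coefC eqxx scal_eq0 ?qc_eq0 // (negbTE x0).
  by rewrite coefC raddf0 mulmx0.
have /closed_rootP[c /factor_theorem[q pE]] : size p != 1%N by rewrite gtn_eqF.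
have q0 : q != 0 by apply: contraNneq p0 => q0; rewrite pE q0 mul0r.
have qn : (size q <= n)%N.
  by move: pn; rewrite pE size_Mmonic ?monicXsubC // size_XsubC addn2.
move: pact; rewrite pE poly_actMXsubC // => /eqP; rewrite subr_eq0 => /eqP ec.
have [qx|qx] := eqVneq (poly_act x n q) 0; first exact: IH qx.
exists (poly_act x n q), (qc c); split=> //.
by apply: (big_ind W) => // i _; apply: WZ.
Qed.

(** [H^N] has real dimension [4N], so the first [4N + 1] iterates have a real linear dependence: a
    left kernel vector of the matrix whose rows are their real coordinates. *)
Lemma krylov_dependent x : exists (n : nat) (p : {poly R[i]}),
  [/\ p != 0, (size p <= n)%N & poly_act x n p = 0].
Proof.
pose crd (q : H) (j : 'I_4) : R :=
  if j == 0 then qre q else if j == 1 then qi q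
  else if j == 2%:R then qj q else qk q.
pose n := (N * 4).+1.
pose M : 'M[R]_(n, N * 4) :=
  \matrix_(i < n) mxvec (\matrix_(m < N, j < 4) crd (iter i T x m 0) j).
have : kermx M != 0.
  rewrite -mxrank_eq0 mxrank_ker -lt0n subn_gt0 ltnS; exact: rank_leq_col.
case/rowV0Pn => v /sub_kermxP vM v0.
pose p : {poly R[i]} := \poly_(i < n) (v 0 (inord i))%:C%C.
have pi (i : 'I_n) : p`_i = (v 0 i)%:C%C by rewrite coef_poly ltn_ord inord_val.
exists n, p; split; last 1 first.
- apply/colP => m; rewrite mxE summxE.
  have crd0 j : \sum_(i < n) crd (iter i T x m 0) j * v 0 i = 0.
    have /rowP /(_ (mxvec_index m j)) := vM; rewrite !mxE => vMj.
    rewrite -[RHS]vMj; apply: eq_bigr => i _.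
    by rewrite !mxE mxvecE mxE mulrC.
  have qE (q : H) r : q * qc r%:C%C = Quat (crd q 0 * r) (crd q 1 * r)
      (crd q 2%:R * r) (crd q 3%:R * r).
    by rewrite /crd /=; case: q => ????; congr Quat => /=; ring.
  under eq_bigr => i _ do rewrite scalE pi qE.
  by rewrite sum_Quat !crd0.
- apply: contraNneq v0 => p0; apply/eqP/rowP => i.
  by have := pi i; rewrite p0 coef0 mxE => -[].
- exact: size_poly.
Qed.

Lemma invariant_eigenvector (W : 'cV[H]_N -> Prop) x :
  (forall y z, W y -> W z -> W (y + z)) ->
  (forall y q, W y -> W (y *m q%:M)) -> (forall y, W y -> W (T y)) ->
  W x -> x != 0 -> exists y l, [/\ W y, y != 0 & T y = y *m l%:M].
Proof.
by move=> *; have [n [p []]] := krylov_dependent x; apply: poly_act_eigen.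
Qed.

(** In the expansion of the squared norm of [S e - e (qconj l)], all four inner products equal
    [qnormsq l * qsqnorm e] and cancel. *)
Lemma normal_adjoint_eigen (S : 'cV[H]_N -> 'cV[H]_N) e l :
  is_adjoint T S -> (forall x, T (S x) = S (T x)) -> T e = e *m l%:M ->
  S e = e *m (qconj l)%:M.
Proof.
move=> TS nTS Te; have ST x y : qdot (S x) y = qdot x (T y).
  by rewrite qdotC -TS -qdotC.
apply/eqP; rewrite -subr_eq0 -qsqnorm_eq0; apply/eqP.
suff : qreal (qsqnorm (S e - e *m (qconj l)%:M)) = qreal 0 by case.
rewrite -qdotxx qdotDl !qdotDr !qdotNl !qdotNr.
have -> : qdot (S e) (S e) = qdot (T e) (T e) by rewrite ST nTS -TS.
have -> : qdot (e *m (qconj l)%:M) (S e) = qdot (T e *m (qconj l)%:M) e.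
  by rewrite -TS TZ.
rewrite ST TZ Te !scalA !qdotZl !qdotZr qdotxx !qconjM !qconjK !mulrA.
rewrite -!(qreal_comm (qsqnorm e)) -!mulrA.
by rewrite qmulxC qconjMx !subrr addr0.
Qed.

Lemma normal_orthogonal_eigenvectors k : normal_op T -> (k <= N)%N ->
  exists e : nat -> 'cV[H]_N,
  [/\ forall i, (i < k)%N -> e i != 0,
      forall i j, (i < k)%N -> (j < k)%N -> i != j -> qdot (e i) (e j) = 0
    & forall i, (i < k)%N -> exists l, T (e i) = e i *m l%:M].
Proof.
case=> S [TS nTS]; elim: k => [|k IH] kN; first by exists (fun=> 0).
have [e [e0 eo el]] := IH (ltnW kN).
have [x [x0 xe]] := orthogonal_extend e0 eo kN.
have [|||y [l [ye y0 yl]]] := invariant_eigenvector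
  (W := fun y => forall i, (i < k)%N -> qdot (e i) y = 0) _ _ _ xe x0.
- by move=> y z hy hz i ik; rewrite qdotDr hy // hz // addr0.
- by move=> y q hy i ik; rewrite qdotZr hy // mul0r.
(* Invariance of the complement: pairing [T y] with [e i] pairs [y] with [S (e i)], a right multiple
   of [e i]. *)
- move=> y hy i ik; have [l /(normal_adjoint_eigen TS nTS) Se] := el i ik.
  by rewrite qdotC TS Se qdotZr qdotC hy // qconj0 mul0r qconj0.
exists (fun i => if i == k then y else e i); split=> [i|i j|i]; rewrite !ltnS.
- by case: (eqVneq i k) => // ik; rewrite leq_eqVlt (negbTE ik) => /e0.
- case: (eqVneq i k) => [->|ik]; case: (eqVneq j k) => [->|jk] //.
  + rewrite (leq_eqVlt j) (negbTE jk) /= => _ jk' _.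
    by rewrite qdotC ye // qconj0.
  + by rewrite leq_eqVlt (negbTE ik) /= => ik' _ _; apply: ye.
  + by rewrite (leq_eqVlt i) (leq_eqVlt j) (negbTE ik) (negbTE jk) /=; apply: eo.
- case: (eqVneq i k) => [_ _|ik]; first by exists l.
  by rewrite leq_eqVlt (negbTE ik) /=; apply: el.
Qed.

End Eigenvectors.
End QuaternionVectors.

(** * Eigenvectors of the difference operator as solutions of the equation *)

Section DifferenceOperator.
Variables (R : realType) (N : nat) (a b : nat -> quat R) (h1 h2 : quat R).
Hypothesis N_gt0 : (0 < N)%N.
Hypothesis b_neq0 : forall k, (k <= N)%N -> b k != 0.

Lemma coordE (x : 'cV[quat R]_N) (i : 'I_N) : Defs.coord x i.+1 = x i 0.
Proof. by rewrite /Defs.coord /= insubT //= => ?; congr (x _ 0); apply: val_inj. Qed.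

Lemma extendE (x : 'cV[quat R]_N) (i : 'I_N) : extend h1 h2 x i.+1 = x i 0.
Proof. by rewrite /extend /= eqSS (ltn_eqF (ltn_ord i)) coordE. Qed.

Lemma eigenvector_is_phi (x : 'cV[quat R]_N) l : diff_op a b h1 h2 x = x *m l%:M ->
  is_phi N a b h1 l (extend h1 h2 x 1) (extend h1 h2 x).
Proof.
move=> xl; split=> //.
- case=> // k kN; have /colP/(_ (Ordinal kN)) := xl.
  by rewrite scalE mxE -extendE.
- rewrite /solves_B1 (extendE x (Ordinal N_gt0)) -coordE.
  by rewrite /extend addNr.
Qed.

Lemma is_phi_scale l s q x : q != 0 -> is_phi N a b h1 l s x ->
  is_phi N a b h1 (q^-1 * l * q) (s * q) (fun k => x k * q).
Proof.
move=> q0 [xE xB x1]; split; last by rewrite x1.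
- move=> k /xE; rewrite /diff_expr => xk.
  have -> : x k * q * (q^-1 * l * q) = x k * l * q.
    by rewrite -[q^-1 * l * q]mulrA -(mulrA (x k)) mulVKr ?quat_unitE // mulrA.
  by rewrite !(mulrA _ _ q) -!mulrDl xk.
- by rewrite /solves_B1 mulrA -mulrDl xB mul0r.
Qed.

Lemma is_phi_zero l : is_phi N a b h1 l 0 (fun=> 0).
Proof. by split=> // [k _|]; rewrite /solves_B1 /diff_expr !mulr0 ?mul0r !addr0. Qed.

Lemma eigenvector_rescale (x : 'cV[quat R]_N) l s phi : s != 0 -> x != 0 ->
  diff_op a b h1 h2 x = x *m l%:M ->
  (forall l', is_phi N a b h1 l' s (phi l')) ->
  exists (l' q : quat R), q != 0 /\ vec N (phi l') = x *m q%:M.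
Proof.
move=> s0 x0 /eigenvector_is_phi xphi phiP.
(* With first value 0, uniqueness would make the solution the zero one. *)
have x10 : extend h1 h2 x 1 != 0.
  apply: contraNneq x0 => x10; apply/eqP/colP => i; rewrite -extendE mxE.
  rewrite x10 in xphi.
  by apply: (is_phi_uniq b_neq0 xphi (is_phi_zero l)); rewrite ltnS ltnW.
(* Chosen so that the rescaled vector starts with [s]. *)
pose q := (extend h1 h2 x 1)^-1 * s.
have q0 : q != 0.
  by rewrite -quat_unitE unitrMr ?quat_unitE // -quat_unitE unitrV quat_unitE.
exists (q^-1 * l * q), q; split=> //; apply/colP => i.
rewrite scalE -(extendE x) mxE.
have := is_phi_scale q0 xphi; rewrite mulVKr ?quat_unitE // => xq.
by rewrite (is_phi_uniq b_neq0 (phiP _) xq) // ltnS ltnW.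
Qed.

End DifferenceOperator.

(** * The sampling expansion *)

Unset Implicit Arguments.

Theorem theorem3p6 (R : realType) (N : nat) (a b : nat -> quat R)
    (h1 h2 : quat R) (phi : nat -> quat R -> quat R -> quat R)
    (N_gt0 : (0 < N)%N)
    (b_neq0 : forall k, (k <= N)%N -> b k != 0)
    (phiP : forall lambda s : quat R,
      is_phi N a b h1 lambda s (fun k => phi k lambda s))
    (L_normal : normal_op (@diff_op R N a b h1 h2))
    (s : quat R) (s_neq0 : s != 0) :
  let varphi (lambda : quat R) := vec N (fun k => phi k lambda s) in
  exists lambda_ : nat -> quat R,
    forall F : nat -> quat R,
    let f (lambda : quat R) :=
      \sum_(1 <= k < N.+1) qconj (F k) * phi k lambda s in
    let psi (k : nat) (lambda : quat R) :=
      qdot (varphi (lambda_ k)) (varphi lambda)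
        / qreal (qnorm (varphi (lambda_ k)) ^+ 2) in
    forall lambda : quat R,
      f lambda = \sum_(1 <= k < N.+1) f (lambda_ k) * psi k lambda.
Proof.
move=> varphi.
have [e [e0 eo el]] := normal_orthogonal_eigenvectors
  (diff_op_right_linear N a b h1 h2) L_normal (leqnn N).
have ex (i : 'I_N) : exists l : quat R, exists q : quat R,
    q != 0 /\ varphi l = e i *m q%:M.
  have [l Tl] := el i (ltn_ord i).
  by apply: (eigenvector_rescale N_gt0 b_neq0
    (phi := fun l k => phi k l s) s_neq0 _ Tl) => //; apply: e0.
have [lam lamP] := fin_all_exists ex.
(* The sampling points are numbered from 1, the eigenvectors from 0. *)
pose lambda_ k := if insub k.-1 is Some i then lam i else 0.
exists lambda_ => F f psi lambda.
have lamE k (kN : (k < N)%N) : exists q : quat R,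
    q != 0 /\ varphi (lambda_ k.+1) = e k *m q%:M.
  by rewrite /lambda_ /= insubT; apply: (lamP (Ordinal kN)).
have fE l : f l = qdot (vec N F) (varphi l).
  by rewrite /f big_add1 big_mkord; apply: eq_bigr => i _; rewrite !mxE.
(* Expand [varphi lambda] in the orthogonal basis [varphi (lambda_ k)] and pair with [F]: the
   coefficients, standing on the right, are the [psi k lambda]. *)
rewrite fE (orthogonal_complete (e := fun k => varphi (lambda_ k.+1)) _ _
  (varphi lambda) (erefl N)) //.
- rewrite (qdot_sumr _ _ (fun i => varphi (lambda_ i.+1) *m
    (qdot (varphi (lambda_ i.+1)) (varphi lambda) *
     qreal (qsqnorm (varphi (lambda_ i.+1)))^-1)%:M)).
  rewrite big_add1 big_mkord; apply: eq_bigr => i _.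
  by rewrite qdotZr fE /psi qnorm_sqr qrealV.
- by move=> i iN; have [q [q0 ->]] := lamE i iN; rewrite scal_eq0 ?e0.
- move=> i j iN jN ij; have [q [_ ->]] := lamE i iN; have [q' [_ ->]] := lamE j jN.
  by rewrite qdotZl qdotZr eo // mul0r mulr0.
Qed.
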